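(* Let $S$ be a bounded set. For $x\in\mathcal X$ define $$\bar g^K(x;\infty)=\left\{\begin{array}{ll}\text{minimize}&\sum_{k=1}^K w_ks_k\\ \text{subject to}&z_k\in\mathbf{R}^m,\ y_k\in\mathbf{R}^m,\ s_k\in\mathbf{R},\quad k=1,\dots,K,\\ &[-g]^*(z_k-y_k,x)+\sigma_S(y_k)-z_k^Td_k+\epsilon\|z_k\|_*\le s_k,\quad k=1,\dots,K.\end{array}\right.$$ Then $\lim_{p\to\infty}\bar g^K(x;p)=\bar g^K(x;\infty)$ for any $x\in\mathcal X$, where $$\bar g^K(x;p)=\max\Big\{\sum_{k=1}^K w_kg(v_k,x)\ :\ \sum_{k=1}^K w_k\|v_k-d_k\|^p\le\epsilon^p,\ v_k\in S,\ k=1,\dots,K\Big\}.$$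
   Context: $S\subseteq\mathbf{R}^m$ is convex and closed; for all $x\in\mathcal X\subseteq\mathbf{R}^n$ ($\mathcal X$ compact) the function $u\mapsto-g(u,x)$ is proper, convex and lower-semicontinuous, with domain $\operatorname{dom}_ug$ independent of $x$ and containing $S$. Moreover either $\operatorname{dom}_ug=\mathbf{R}^m$, or $g$ is element-wise monotonically increasing in $u$ and its domain only has a (potential) lower bound, or $g$ is element-wise monotonically decreasing in $u$ and its domain only has a (potential) upper bound. $\|\cdot\|$ is a norm on $\mathbf{R}^m$ with dual norm $\|\cdot\|_*$, and $\epsilon>0$. The points $d_1,\dots,d_K\in S$ are the centroids of the $K$ nonempty clusters $C_1,\dots,C_K$ into which a data set of $N$ points of $S$ is partitioned, and $w_k=|C_k|/N>0$. $[-g]^*(z,x)=\sup_{u\in\operatorname{dom}_ug}\{z^Tu+g(u,x)\}$ is the conjugate of $-g$ in $u$, and $\sigma_S(y)=\sup_{u\in S}y^Tu$ is the support function. ''Minimize'' denotes the infimum. *)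

(* Defs.v *)
From HB Require Import structures.
From mathcomp Require Export all_boot all_order all_algebra.
From mathcomp Require Export all_classical all_reals all_analysis.
Export Order.TTheory GRing.Theory Num.Theory.
Export numFieldNormedType.Exports.

Set Implicit Arguments.
Unset Strict Implicit.
Unset Printing Implicit Defensive.

Local Open Scope classical_set_scope.
Local Open Scope ring_scope.

(* Vectors of R^m are row vectors; all topological notions on 'rV[R]_m are the
   library's (product topology).  The norm of the ambiguity set is a separate,
   arbitrary function [nrm], not the library norm `|_| on 'rV[R]_m. *)

Definition dot (R : realType) (m : nat) (z u : 'rV[R]_m) : R :=
  (z *m u^T) 0 0.

Record is_norm (R : realType) (m : nat) (nrm : 'rV[R]_m -> R) : Prop := IsNorm {
  norm_triangle : forall u v, nrm (u + v) <= nrm u + nrm v ;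
  norm_scale : forall (a : R) u, nrm (a *: u) = `|a| * nrm u ;
  norm_eq0 : forall u, nrm u = 0 -> u = 0
}.

Definition dual_norm (R : realType) (m : nat) (nrm : 'rV[R]_m -> R)
    (z : 'rV[R]_m) : \bar R :=
  ereal_sup [set (dot z u)%:E | u in [set u | nrm u <= 1]].

Definition support_fun (R : realType) (m : nat) (S : set 'rV[R]_m)
    (y : 'rV[R]_m) : \bar R :=
  ereal_sup [set (dot y u)%:E | u in S].

Definition proper_fun (R : realType) (m : nat) (f : 'rV[R]_m -> \bar R) : Prop :=
  (forall u, (-oo < f u)%E) /\ (exists u, (f u < +oo)%E).

(* The library's [convex_function] is for real-valued functions only.  The
   weights are taken in the open interval so that 0 * +oo never occurs. *)
Definition convex_efun (R : realType) (m : nat) (f : 'rV[R]_m -> \bar R) : Prop :=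
  forall (u v : 'rV[R]_m) (t : R), 0 < t < 1 ->
    (f (t *: u + (1 - t) *: v)%R <= t%:E * f u + (1 - t)%:E * f v)%E.

Section Uncertain.
Context {R : realType} {m n : nat} (g : 'rV[R]_m -> 'rV[R]_n -> \bar R).

(* [g] is concave in [u] and takes the value -oo outside its domain. *)
Definition domu (x : 'rV[R]_n) : set 'rV[R]_m := [set u | (-oo < g u x)%E].

Definition conj_neg (z : 'rV[R]_m) (x : 'rV[R]_n) : \bar R :=
  ereal_sup [set ((dot z u)%:E + g u x)%E | u in domu x].

Definition lev (u v : 'rV[R]_m) : Prop := forall i, u 0 i <= v 0 i.

(* The domain is not bounded from above: increasing coordinates never leaves
   it. *)
Definition increasing_lower_bounded (x : 'rV[R]_n) : Prop :=
  (forall u v, domu x u -> domu x v -> lev u v -> (g u x <= g v x)%E) /\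
  (forall u v, domu x u -> lev u v -> domu x v).

Definition decreasing_upper_bounded (x : 'rV[R]_n) : Prop :=
  (forall u v, domu x u -> domu x v -> lev u v -> (g v x <= g u x)%E) /\
  (forall u v, domu x v -> lev u v -> domu x u).

Definition domain_alternative (X : set 'rV[R]_n) : Prop :=
  [\/ forall x, X x -> domu x = setT,
      forall x, X x -> increasing_lower_bounded x |
      forall x, X x -> decreasing_upper_bounded x].

Context (S : set 'rV[R]_m) (nrm : 'rV[R]_m -> R) (eps : R).
Context {K : nat} (w : 'I_K -> R) (d : 'I_K -> 'rV[R]_m).

Definition gbar_values (x : 'rV[R]_n) (p : R) : set (\bar R) :=
  [set (\sum_(k < K) (w k)%:E * g (v k) x)%E |
    v in [set v : 'I_K -> 'rV[R]_m |
           \sum_(k < K) w k * nrm (v k - d k) `^ p <= eps `^ p /\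
           forall k, S (v k)]].

Definition gbar (x : 'rV[R]_n) (p : R) : \bar R := ereal_sup (gbar_values x p).

Definition gbar_infty (x : 'rV[R]_n) : \bar R :=
  ereal_inf [set t : \bar R |
    exists (z y : 'I_K -> 'rV[R]_m) (s : 'I_K -> R),
      (forall k, (conj_neg (z k - y k)%R x + support_fun S (y k)
                  - (dot (z k) (d k))%:E
                  + eps%:E * dual_norm nrm (z k) <= (s k)%:E)%E) /\
      t = (\sum_(k < K) w k * s k)%:E].

End Uncertain.

Section Clusters.
Context {R : realType} {m N K : nat}.

(* A data set is a family indexed by 'I_N, so repeated points are allowed;
   clusters are sets of indices. *)
Definition is_clustering (C : 'I_K -> {set 'I_N}) : Prop :=
  injective C /\ finset.partition (C @: 'I_K)%SET [set: 'I_N]%SET.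

Definition centroid (data : 'I_N -> 'rV[R]_m) (C : 'I_K -> {set 'I_N})
    (k : 'I_K) : 'rV[R]_m :=
  (#|C k|%:R)^-1 *: \sum_(i in C k) data i.

Definition weight (C : 'I_K -> {set 'I_N}) (k : 'I_K) : R :=
  #|C k|%:R / N%:R.

End Clusters.

(* Main.v *)
Require Import Defs.
From mathcomp Require Import ring lra.

(** The value at p = oo is the dual of the problem that one expects in the
    limit, namely maximizing g(v, x) cluster by cluster over the points of S at
    distance at most eps from the centroid d.  Both halves of the convergence go
    through the dual constraints.

    Upper bound.  By weak duality, dual variables (z, y, s) of one cluster
    bound g on all of S, not only on the ball: [weak_duality] gives
    g(v, x) <= s + D (|v - d| - eps), where D is the dual norm of z.  A point v
    admissible for p satisfies w_k |v_k - d_k|^p <= eps^p, hence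
    |v_k - d_k| <= eps + eta as soon as p is large ([powR_constraint_near]).  So
    for every dual feasible choice, the value at p is eventually at most the
    dual objective plus any prescribed error ([gbar_le_near]).

    Lower bound.  Take in each cluster a maximizer of g over S and the ball of
    radius eps.  Since the weights sum to at most 1, these points are admissible
    for every p, so the value at p dominates the weighted sum of the maxima.
    By [strong_duality], any level strictly above such a maximum is attained by
    dual variables of the cluster, so this sum also dominates the value at
    p = oo ([gbar_infty_le_gbar]).

    Strong duality is a single separation.  If c exceeds g on S and the ball,
    then no (u, r, v, q) with r <= g(u, x), v in S, q in the ball satisfies
    u = v, u = q and r = c.  Minimizing |u - v|^2 + |u - q|^2 + (c - r)^2 over
    this closed convex set gives a positive minimum; the first order condition
    at the minimizer is a linear inequality whose coefficients, after division
    by the one of r, are the dual variables.  That coefficient is nonzero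
    because d lies in S and at the centre of the ball, which is where the
    constraint qualification enters.  Boundedness of S makes the sublevel sets
    of the quadratic compact. *)

Set Implicit Arguments.
Unset Strict Implicit.
Unset Printing Implicit Defensive.

Local Open Scope classical_set_scope.
Local Open Scope ring_scope.

(** * Lower semicontinuous functions *)

Section Semicontinuity.
Context {R : realType}.
Implicit Types (T U : topologicalType).

Lemma lsc_closed_sublevel T (f : T -> \bar R) (a : R) :
  lower_semicontinuous f -> closed [set x | (f x <= a%:E)%E].
Proof.
move=> /lower_semicontinuousP /(_ a); rewrite -closedC; congr closed.
by apply/seteqP; split=> x /=; rewrite ltNge;
  [move/negP; rewrite negbK|move=> ->].
Qed.

Lemma lsc_comp T U (h : U -> T) (f : T -> \bar R) :
  continuous h -> lower_semicontinuous f -> lower_semicontinuous (f \o h).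
Proof.
move=> h_cont f_lsc x a /f_lsc[V xV fV].
by exists (h @^-1` V); [exact: h_cont|move=> y; exact: fV].
Qed.

Lemma continuous_lsc T (f : T -> R) :
  continuous f -> lower_semicontinuous (EFin \o f).
Proof.
move=> f_cont x a; rewrite /= lte_fin => afx.
exists (f @^-1` [set t | a < t]); last by move=> y /=; rewrite lte_fin.
by apply: f_cont; apply: open_nbhs_nbhs; split=> //; exact: open_gt.
Qed.

Lemma lt_adde_split (x y : \bar R) (a : R) : (-oo < x)%E -> (-oo < y)%E ->
  (a%:E < x + y)%E ->
  exists b c : R, [/\ (b%:E < x)%E, (c%:E < y)%E & a <= b + c].
Proof.
case: x => [r| |] // _; case: y => [s| |] // _.
- rewrite -EFinD lte_fin => ars.
  exists (r - (r + s - a) / 2), (s - (r + s - a) / 2).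
  by rewrite !lte_fin; split; lra.
- by move=> _; exists (r - 1), (a - r + 1);
    rewrite lte_fin ltry; split=> //; lra.
- by move=> _; exists (a - s + 1), (s - 1);
    rewrite lte_fin ltry; split=> //; lra.
- by move=> _; exists a, 0; rewrite !ltry addr0.
Qed.

Lemma lscD T (f h : T -> \bar R) :
  (forall x, (-oo < f x)%E) -> (forall x, (-oo < h x)%E) ->
  lower_semicontinuous f -> lower_semicontinuous h ->
  lower_semicontinuous (fun x => f x + h x)%E.
Proof.
move=> fNy hNy f_lsc h_lsc x a /(lt_adde_split (fNy x) (hNy x))[b [c [bf ch abc]]].
have [V xV fV] := f_lsc _ _ bf; have [W xW hW] := h_lsc _ _ ch.
exists (V `&` W); first exact: filterI.
move=> y [/fV bfy /hW chy]; apply: (@le_lt_trans _ _ (b%:E + c%:E)%E).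
  by rewrite -EFinD lee_fin.
exact: lteD.
Qed.

Lemma lsc_sum T (I : Type) (r : seq I) (f : I -> T -> \bar R) :
  (forall i x, (-oo < f i x)%E) -> (forall i, lower_semicontinuous (f i)) ->
  lower_semicontinuous (fun x => \sum_(i <- r) f i x)%E.
Proof.
move=> fNy f_lsc; elim: r => [|i r IHr].
  under eq_fun do rewrite big_nil.
  by apply: (@continuous_lsc _ (fun=> 0)) => x; exact: cvg_cst.
under eq_fun do rewrite big_cons.
apply: lscD; [exact: fNy|move=> x|exact: f_lsc|exact: IHr].
apply: (big_ind (fun y => -oo < y)%E) => [//|y z yNy zNy|j _].
  exact: (lteD yNy zNy).
exact: fNy.
Qed.

Lemma lscZ T (a : R) (f : T -> \bar R) : 0 < a ->
  lower_semicontinuous f -> lower_semicontinuous (fun x => a%:E * f x)%E.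
Proof.
move=> a0 f_lsc x b; rewrite -lte_pdivrMl // -EFinM => /f_lsc[V xV fV].
by exists V => // y /fV; rewrite EFinM lte_pdivrMl.
Qed.

(** If no minimum is attained, the sets of points of A where f is at most f a,
    for a in A, form a proper filter base; at a cluster point a of it, lower
    semicontinuity keeps f away from the values taken strictly below f a. *)
Lemma lsc_attains_min T (f : T -> \bar R) (A : set T) :
  A !=set0 -> compact A -> lower_semicontinuous f ->
  exists2 a, A a & forall b, A b -> (f a <= f b)%E.
Proof.
move=> [a0 Aa0] A_compact f_lsc; apply: contrapT => noMin.
have {}noMin a : A a -> exists2 b, A b & (f b < f a)%E.
  move=> Aa; apply: contrapT => noB; apply: noMin; exists a => // b Ab.
  by rewrite leNgt; apply/negP => fba; apply: noB; exists b.
pose F := filter_from A (fun a => [set b | A b /\ (f b <= f a)%E]).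
have FF : ProperFilter F.
  apply: filter_from_proper; last by move=> a Aa; exists a.
  apply: filter_from_filter; first by exists a0.
  move=> a b Aa Ab; have [fab|/ltW fba] := leP (f a) (f b).
    exists a => // c [Ac fca]; split; split=> //; exact: le_trans fab.
  exists b => // c [Ac fcb]; split; split=> //; exact: le_trans fba.
have FA : F A by exists a0 => // b [].
have [a [Aa aF]] := A_compact F FF FA.
have [b Ab fba] := noMin a Aa.
have [t fbt tfa] : exists2 t : R, (f b <= t%:E)%E & (t%:E < f a)%E.
  case: (f b) fba => [r fra|/lt_le_trans/(_ (leey _))|]; [by exists r|by rewrite ltxx|].
  case: (f a) => [r _|_|]; [|by exists 0; rewrite ?ltry ?leNye|by rewrite ltxx].
  by exists (r - 1); rewrite ?leNye // lte_fin ltrBlDr ltrDl.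
have [V aV fV] := f_lsc _ _ tfa.
have Fb : F [set c | A c /\ (f c <= f b)%E] by exists b.
have [c [[_ fcb] /fV]] := aF _ _ Fb aV.
by rewrite ltNge (le_trans fcb fbt).
Qed.

End Semicontinuity.

(** * The dot product and norms *)

Section Dot.
Context {R : realType} {m : nat}.
Implicit Types u v z : 'rV[R]_m.

Lemma dotE z u : dot z u = \sum_i z 0 i * u 0 i.
Proof. by rewrite /dot mxE; apply: eq_bigr => i _; rewrite mxE. Qed.

Lemma dotC u v : dot u v = dot v u.
Proof. by rewrite !dotE; apply: eq_bigr => i _; rewrite mulrC. Qed.

Lemma dotDr z u v : dot z (u + v) = dot z u + dot z v.
Proof. by rewrite /dot linearD mulmxDr mxE. Qed.

Lemma dotZr z a u : dot z (a *: u) = a * dot z u.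
Proof. by rewrite /dot linearZ -scalemxAr mxE. Qed.

Lemma dotNr z u : dot z (- u) = - dot z u.
Proof. by rewrite -scaleN1r dotZr mulN1r. Qed.

Lemma dotBr z u v : dot z (u - v) = dot z u - dot z v.
Proof. by rewrite dotDr dotNr. Qed.

Lemma dotr0 z : dot z 0 = 0.
Proof. by rewrite -(scale0r 0) dotZr mul0r. Qed.

Lemma dotDl z u v : dot (u + v) z = dot u z + dot v z.
Proof. by rewrite !(dotC _ z) dotDr. Qed.

Lemma dotZl z a u : dot (a *: u) z = a * dot u z.
Proof. by rewrite !(dotC _ z) dotZr. Qed.

Lemma dotNl z u : dot (- u) z = - dot u z.
Proof. by rewrite !(dotC _ z) dotNr. Qed.

Lemma dotBl z u v : dot (u - v) z = dot u z - dot v z.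
Proof. by rewrite !(dotC _ z) dotBr. Qed.

Definition dot_lin := (dotDr, dotDl, dotBr, dotBl, dotNr, dotNl, dotZr, dotZl).

Lemma dot_ge0 u : 0 <= dot u u.
Proof. by rewrite dotE; apply: sumr_ge0 => i _; rewrite -expr2 sqr_ge0. Qed.

Lemma norm_sqr_le_dot u : `|u| ^+ 2 <= dot u u.
Proof.
have [->|] := eqVneq u 0; first by rewrite normr0 expr0n dot_ge0.
rewrite -normr_eq0 => /mx_norm_neq0[[i j] /= uE].
rewrite [`|u|]uE real_normK ?num_real // (ord1 i) dotE (bigD1 j) //=.
by rewrite -expr2 lerDl; apply: sumr_ge0 => k _; rewrite -expr2 sqr_ge0.
Qed.

Lemma dot_eq0 u : dot u u = 0 -> u = 0.
Proof.
move=> u0; apply/eqP; rewrite -normr_eq0 -sqrf_eq0 eq_le sqr_ge0 andbT.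
by rewrite -u0 norm_sqr_le_dot.
Qed.

Lemma dot_diag_continuous : continuous (fun u => dot u u).
Proof.
under eq_fun do rewrite dotE.
apply: continuous_big => [|i _ u]; first exact: add_continuous.
by apply: (@continuousM R _ (fun v => v 0 i) (fun v => v 0 i));
  exact: coord_continuous.
Qed.

End Dot.

Section Norm.
Context {R : realType} {m : nat} (nrm : 'rV[R]_m -> R).
Hypothesis nrm_norm : is_norm nrm.
Implicit Types u v z : 'rV[R]_m.

Lemma nrm0 : nrm 0 = 0.
Proof. by rewrite -(scale0r 0) (norm_scale nrm_norm) normr0 mul0r. Qed.

Lemma nrmN u : nrm (- u) = nrm u.
Proof. by rewrite -scaleN1r (norm_scale nrm_norm) normrN normr1 mul1r. Qed.

Lemma nrm_ge0 u : 0 <= nrm u.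
Proof.
have := norm_triangle nrm_norm u (- u); rewrite subrr nrm0 nrmN.
by rewrite -mulr2n pmulrn_lge0.
Qed.

Lemma nrm_gt0 u : u != 0 -> 0 < nrm u.
Proof.
move=> u0; rewrite lt_neqAle nrm_ge0 andbT eq_sym.
by apply: contraNneq u0 => /(norm_eq0 nrm_norm) ->.
Qed.

(** One half of the equivalence of norms, by expansion in the canonical basis;
    it is what makes [nrm] continuous for the product topology. *)
Lemma nrm_le_mx_norm : exists2 c : R, 0 < c & forall u, nrm u <= c * `|u|.
Proof.
exists (1 + \sum_(i < m) nrm (delta_mx 0 i)).
  by apply: ltr_pwDl => //; apply: sumr_ge0 => i _; exact: nrm_ge0.
move=> u; rewrite {1}[u]row_sum_delta mulrDl mul1r mulr_suml.
apply: ler_wpDl => //.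
elim/big_ind2: _ => [|a b c d ab cd|i _]; first by rewrite nrm0.
  exact: le_trans (norm_triangle nrm_norm _ _) (lerD ab cd).
rewrite (norm_scale nrm_norm) mulrC ler_wpM2l ?nrm_ge0 //.
have := @le_bigmax _ _ _ 0 (fun ij : 'I_1 * 'I_m => `|u ij.1 ij.2|) (0, i).
by rewrite -mx_normrE.
Qed.

Lemma nrm_continuous : continuous nrm.
Proof.
have [c c0 nrmc] := nrm_le_mx_norm.
move=> u; apply/(@cvgrPdist_le _ _ _ (nbhs u) (nbhs_filter u)) => e e0.
apply/nbhs_ballP; exists (e / c); first exact: divr_gt0.
move=> v; rewrite mx_norm_ball /ball_ /= => /ltW uve.
have nrm_sub x y : nrm x - nrm y <= nrm (x - y).
  by rewrite lerBlDr; have := norm_triangle nrm_norm (x - y) y; rewrite subrK.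
apply: (@le_trans _ _ (nrm (u - v))).
  by rewrite ler_norml nrm_sub andbT lerNl opprB -(nrmN (u - v)) opprB nrm_sub.
by apply: le_trans (nrmc _) _; rewrite mulrC -ler_pdivlMr.
Qed.

Lemma dot_le_dual z D v : dual_norm nrm z = D%:E -> dot z v <= D * nrm v.
Proof.
move=> zD; have [->|v0] := eqVneq v 0.
  by rewrite nrm0 mulr0 dotr0.
rewrite -ler_pdivrMr ?nrm_gt0 // mulrC -dotZr -lee_fin -zD.
apply: ereal_sup_ubound; exists ((nrm v)^-1 *: v) => //=.
rewrite (norm_scale nrm_norm) ger0_norm ?invr_ge0 ?nrm_ge0 //.
by rewrite mulVf // gt_eqF ?nrm_gt0.
Qed.

Lemma dual_norm_ge0 z : (0 <= dual_norm nrm z)%E.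
Proof.
apply: ereal_sup_ubound; exists 0; first by rewrite /= nrm0.
by rewrite dotr0.
Qed.

End Norm.

(** * Convex sets and the separation argument *)

Section ConvexSet.
Context {R : realType} {m : nat} (S : set 'rV[R]_m).
Hypothesis S_convex : convex_set S.

Lemma convex_setP u v (t : R) : 0 <= t -> t <= 1 -> S u -> S v ->
  S (t *: u + (1 - t) *: v).
Proof.
move=> t0 t1 Su Sv.
by have := S_convex (Itv01 t0 t1) (mem_set Su) (mem_set Sv); rewrite inE.
Qed.

Lemma convex_set_mean (I : Type) (x : I) (r : seq I) (f : I -> 'rV[R]_m) :
  (forall i, S (f i)) ->
  S ((size (x :: r))%:R^-1 *: \sum_(i <- x :: r) f i).
Proof.
move=> Sf; elim: r x => [|y r IHr] x.
  by rewrite big_seq1 invr1 scale1r.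
rewrite big_cons scalerDr.
set n := size (y :: r); have n0 : (n%:R : R) != 0 by rewrite pnatr_eq0.
have -> : size [:: x, y & r] = n.+1 by [].
have n1 : (n.+1%:R : R) != 0 by rewrite pnatr_eq0.
have -> : n.+1%:R^-1 *: \sum_(i <- y :: r) f i =
    (1 - n.+1%:R^-1) *: (n%:R^-1 *: \sum_(i <- y :: r) f i).
  rewrite scalerA; congr (_ *: _); apply: (mulfI n1).
  by rewrite mulrA mulrBr mulr1 divff // -natr1 addrK divff.
apply: convex_setP; rewrite ?invr_ge0 //; last exact: IHr.
by rewrite invf_le1 ?ltr0n // ler1n.
Qed.

End ConvexSet.

(** First order optimality of a quadratic along a segment: for small t the
    linear term decides the sign. *)
Lemma ge0_linear_term (R : realFieldType) (b n : R) :
  (forall t, 0 < t < 1 -> 0 <= 2 * t * b + t ^+ 2 * n) -> 0 <= b.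
Proof.
move=> bn; rewrite leNgt; apply/negP => b0.
have D0 : 0 < `|n| + 1 - b by have := normr_ge0 n; lra.
(* If b < 0, at this t the quadratic term is too small to compensate. *)
pose t := - b / (`|n| + 1 - b).
have t0 : 0 < t by rewrite divr_gt0 ?oppr_gt0.
have t1 : t < 1 by rewrite ltr_pdivrMr // mul1r; have := normr_ge0 n; lra.
have tD : t * (`|n| + 1 - b) = - b by rewrite divfK // gt_eqF.
have tn : t * n <= t * `|n| by rewrite ler_pM2l // ler_norm.
have tb : 0 < t * (1 - b) by rewrite mulr_gt0 //; lra.
have := bn t; rewrite t0 t1 => /(_ isT).
rewrite expr2 (_ : _ + _ = t * (2 * b + t * n)); last by ring.
rewrite pmulr_rge0 //; lra.
Qed.

Section StrongDuality.
Context {R : realType} {m : nat}.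
Variables (S : set 'rV[R]_m) (nrm : 'rV[R]_m -> R) (eps : R).
Hypotheses (S_convex : convex_set S) (S_closed : closed S).
Hypothesis S_bounded : bounded_set S.
Hypotheses (nrm_norm : is_norm nrm) (eps_gt0 : 0 < eps).
Variable f : 'rV[R]_m -> \bar R.
Hypothesis fNy : forall u, (-oo < f u)%E.
Hypothesis f_convex : convex_efun f.
Hypothesis f_lsc : lower_semicontinuous f.
Hypothesis f_fin : forall v, S v -> (f v < +oo)%E.
Variables (d : 'rV[R]_m) (c : R).
Hypothesis Sd : S d.
Hypothesis c_lt : forall v, S v -> nrm (v - d) <= eps -> (c%:E < f v)%E.

(** A tuple ((u, r), (v, q)) of E consists of a point of the epigraph of f, a
    point of S and a point of the ball; Q measures by how much these fail to
    coincide at height c. *)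
Let T := ('rV[R]_m * R * ('rV[R]_m * 'rV[R]_m))%type.

Let E : set T := [set e |
  [/\ (f e.1.1 - e.1.2%:E <= 0%:E)%E, S e.2.1 & nrm (e.2.2 - d) <= eps]].

Let Q (e : T) : R := dot (e.1.1 - e.2.1) (e.1.1 - e.2.1)
  + dot (e.1.1 - e.2.2) (e.1.1 - e.2.2) + (c - e.1.2) ^+ 2.

Let u_c : continuous (fun e : T => e.1.1).
Proof. by move=> e; apply: continuous_comp; [exact: cvg_fst|exact: cvg_fst]. Qed.

Let r_c : continuous (fun e : T => e.1.2).
Proof. by move=> e; apply: continuous_comp; [exact: cvg_fst|exact: cvg_snd]. Qed.

Let v_c : continuous (fun e : T => e.2.1).
Proof. by move=> e; apply: continuous_comp; [exact: cvg_snd|exact: cvg_fst]. Qed.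

Let q_c : continuous (fun e : T => e.2.2).
Proof. by move=> e; apply: continuous_comp; [exact: cvg_snd|exact: cvg_snd]. Qed.

Let Q_continuous : continuous Q.
Proof.
move=> e; apply: cvgD.
  apply: cvgD.
    apply: (@continuous_comp _ _ _ (fun e : T => e.1.1 - e.2.1)
      (fun u => dot u u)).
      by apply: cvgB; [exact: u_c|exact: v_c].
    exact: dot_diag_continuous.
  apply: (@continuous_comp _ _ _ (fun e : T => e.1.1 - e.2.2) (fun u => dot u u)).
    by apply: cvgB; [exact: u_c|exact: q_c].
  exact: dot_diag_continuous.
apply: (@continuous_comp _ _ _ (fun e : T => c - e.1.2) (fun t => t ^+ 2)).
  by apply: cvgB; [exact: cvg_cst|exact: r_c].
exact: exprn_continuous.
Qed.

Let E_closed : closed E.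
Proof.
rewrite (_ : E = [set e | (f e.1.1 - e.1.2%:E <= 0%:E)%E] `&`
    ((fun e : T => e.2.1) @^-1` S `&`
     [set e | ((nrm (e.2.2 - d))%:E <= eps%:E)%E])); last first.
  by apply/seteqP; split=> e /=; rewrite !lee_fin;
    [case=> ? ? ?; split|case=> ? [? ?]; split].
apply: closedI; last apply: closedI.
- apply: lsc_closed_sublevel; apply: lscD => [e|e||].
  + exact: fNy.
  + by rewrite -EFinN ltNyr.
  + by apply: (@lsc_comp R _ _ (fun e : T => e.1.1) f).
  + by apply: (@continuous_lsc R _ (fun e : T => - e.1.2)) => e;
      apply: cvgN; exact: r_c.
- by apply: preimage_closed => // e _; exact: v_c.
- apply: (lsc_closed_sublevel (f := fun e : T => (nrm (e.2.2 - d))%:E)).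
  apply: (@continuous_lsc R _ (fun e : T => nrm (e.2.2 - d))) => e.
  apply: (@continuous_comp _ _ _ (fun e : T => e.2.2 - d) nrm).
    by apply: cvgB; [exact: q_c|exact: cvg_cst].
  exact: nrm_continuous.
Qed.

Let ball_compact (r : R) : compact [set u : 'rV[R]_m | `|u| <= r].
Proof.
apply: bounded_closed_compact; last first.
  rewrite (_ : [set _ | _] = Num.norm @^-1` [set t | t <= r]) //.
  apply: preimage_closed; last exact: closed_le.
  by move=> u _; exact: norm_continuous.
by exists r; split; [exact: num_real|move=> s rs u /= ur; exact: le_trans (ltW rs)].
Qed.

(** The epigraph is unbounded, but the part of E in a sublevel set of Q is not:
    Q keeps u close to the bounded set S, then q close to u, and r
    close to c. *)
Let E_min : exists2 e, E e & forall e', E e' -> Q e <= Q e'.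
Proof.
have [M [_ SM]] := S_bounded.
have {}SM v : S v -> `|v| <= M + 1 by apply: SM; rewrite ltrDl.
have [r fdE] : exists r, f d = r%:E.
  by have := fNy d; have := f_fin Sd; case: (f d) => [r| |] // _ _; exists r.
pose e0 : T := ((d, r), (d, d)).
have Ee0 : E e0.
  by split; rewrite /= ?fdE ?subee // subrr (nrm0 nrm_norm) ltW.
pose rho := Q e0 + 1.
have Q0_ge0 : 0 <= Q e0 by rewrite !addr_ge0 ?dot_ge0 ?sqr_ge0.
have Q0_le : Q e0 <= rho ^+ 2 by rewrite /rho; nra.
have rho0 : 0 <= rho by rewrite addr_ge0.
pose A := E `&` [set e | Q e <= Q e0].
have A_closed : closed A.
  apply: closedI => //.
  by apply: (preimage_closed (f := Q) (D := [set t | t <= Q e0]));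
    [move=> e _; exact: Q_continuous|exact: closed_le].
have A_compact : compact A.
  apply: (@subclosed_compact _ A
    (([set u | `|u| <= M + 1 + rho] `*` `[c - rho, c + rho]%classic) `*`
     ([set u | `|u| <= M + 1] `*` [set u | `|u| <= M + 1 + rho + rho]))) => //.
    by apply: compact_setX; apply: compact_setX => //; exact: segment_compact.
  move=> [[u t] [v q]] [[/= _ Sv _]].
  rewrite [X in X <= _ -> _](_ : _ =
    dot (u - v) (u - v) + dot (u - q) (u - q) + (c - t) ^+ 2) // => Qe.
  have := dot_ge0 (u - v); have := dot_ge0 (u - q); have := sqr_ge0 (c - t).
  have norm_le (w : 'rV[R]_m) : dot w w <= Q e0 -> `|w| <= rho.
    move=> wQ; rewrite -ler_sqr ?nnegrE //.
    exact: le_trans (norm_sqr_le_dot w) (le_trans wQ Q0_le).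
  move=> ct uq uv.
  have uv_le : `|u - v| <= rho by apply: norm_le; lra.
  have uq_le : `|q - u| <= rho by rewrite distrC; apply: norm_le; lra.
  have u_le : `|u| <= M + 1 + rho.
    by rewrite -(subrK v u) addrC (le_trans (ler_normD _ _)) // lerD // SM.
  split; split=> /=; [exact: u_le| |exact: SM|].
    rewrite in_itv /= -ler_distlC -(ler_pXn2r (n := 2)) ?nnegrE //.
    rewrite real_normK ?num_real //.
    by rewrite -sqrrN opprB; lra.
  by rewrite -(subrK u q) addrC (le_trans (ler_normD _ _)) // lerD.
have [e /set_mem[Ee eQ] emin] :
    exists2 e, e \in A & forall e', e' \in A -> Q e <= Q e'.
  apply: compact_EVT_min => //; first by exists e0; split => /=.
  exact: continuous_subspaceT.
exists e => // e' Ee'; have [e'Q|/ltW] := leP (Q e') (Q e0).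
  by apply: emin; rewrite inE.
exact: le_trans.
Qed.

(** The first order condition at a minimizer of Q over E.  With f = - g and the
    level - c, the conclusion is the dual constraint before its three suprema
    (over u, over v in S and over h in the unit ball) are taken; they are
    introduced one at a time in [strong_duality]. *)
Lemma strong_duality_real : exists z y : 'rV[R]_m, forall u r v h,
  (f u <= r%:E)%E -> S v -> nrm h <= 1 ->
  dot (z - y) u - r + dot y v - dot z d + eps * dot z h <= - c.
Proof.
have [[[u0 r0] [v0 q0]] [/= f0 Sv0 q0d] Qmin] := E_min.
pose a1 := u0 - v0; pose a2 := u0 - q0; pose b := c - r0.
pose alpha := dot a1 a1 + dot a2 a2 + b ^+ 2.
have epi u r : (f u - r%:E <= 0)%E = (f u <= r%:E)%E by rewrite leeBlDr // add0e.
have alpha_gt0 : 0 < alpha.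
  have := dot_ge0 a1; have := dot_ge0 a2; have := sqr_ge0 b => b0 a20 a10.
  rewrite lt_neqAle !addr_ge0 // andbT eq_sym; apply/negP => /eqP alpha0.
  have /dot_eq0/subr0_eq u0v0 : dot a1 a1 = 0 by rewrite /alpha in alpha0; lra.
  have /dot_eq0/subr0_eq u0q0 : dot a2 a2 = 0 by rewrite /alpha in alpha0; lra.
  have /eqP : b ^+ 2 = 0 by rewrite /alpha in alpha0; lra.
  rewrite sqrf_eq0 => /eqP/subr0_eq cr0.
  have := c_lt Sv0; rewrite -u0v0 {1}u0q0 => /(_ q0d).
  by rewrite cr0 ltNge -epi f0.
(* The variational inequality, from the segment towards another point of E. *)
have var u r v q : (f u <= r%:E)%E -> S v -> nrm (q - d) <= eps ->
    alpha <= dot a1 (u - v) + dot a2 (u - q) + b * (c - r).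
  move=> fu Sv qd; rewrite -subr_ge0.
  pose p1 := u - v - a1; pose p2 := u - q - a2; pose p3 := (c - r) - b.
  have -> : dot a1 (u - v) + dot a2 (u - q) + b * (c - r) - alpha =
      dot a1 p1 + dot a2 p2 + b * p3.
    by rewrite /alpha /p1 /p2 /p3 !(dotBr a1 (u - v)) !(dotBr a2 (u - q)); ring.
  apply: (@ge0_linear_term _ _ (dot p1 p1 + dot p2 p2 + p3 ^+ 2)) => t t01.
  have /andP[t0 t1] := t01.
  pose et : T := ((t *: u + (1 - t) *: u0, t * r + (1 - t) * r0),
    (t *: v + (1 - t) *: v0, t *: q + (1 - t) *: q0)).
  have Eet : E et.
    split; rewrite /et /=.
    - rewrite epi; apply: le_trans (f_convex u u0 t01) _.
      rewrite [leRHS]EFinD !EFinM; apply: leeD; rewrite lee_pmul2l ?lte_fin ?subr_gt0 //.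
      by rewrite -epi.
    - by apply: convex_setP => //; exact: ltW.
    - have -> : t *: q + (1 - t) *: q0 - d = t *: (q - d) + (1 - t) *: (q0 - d).
        by rewrite !scalerBr [RHS]addrACA -opprD -scalerDl (addrC t) subrK scale1r.
      apply: le_trans (norm_triangle nrm_norm _ _) _.
      rewrite !(norm_scale nrm_norm) !ger0_norm ?subr_ge0; [|exact: ltW..].
      have := ler_wpM2l (ltW t0) qd.
      have : (1 - t) * nrm (q0 - d) <= (1 - t) * eps.
        by rewrite ler_wpM2l // subr_ge0 ltW.
      lra.
  have := Qmin _ Eet; rewrite -subr_ge0 {1}/Q /=.
  have -> : t *: u + (1 - t) *: u0 - (t *: v + (1 - t) *: v0) = a1 + t *: p1.
    by apply/rowP => i; rewrite /p1 /a1 !mxE; ring.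
  have -> : t *: u + (1 - t) *: u0 - (t *: q + (1 - t) *: q0) = a2 + t *: p2.
    by apply/rowP => i; rewrite /p2 /a2 !mxE; ring.
  rewrite /Q /= -/a1 -/a2 -/b.
  have -> : c - (t * r + (1 - t) * r0) = b + t * p3 by rewrite /p3 /b; ring.
  clearbody a1 a2 b p1 p2 p3.
  by rewrite !dot_lin (dotC p1 a1) (dotC p2 a2); congr (0 <= _); ring.
(* At u = v = q = d and r = f d > c only the term b (c - r) remains. *)
have b_lt0 : b < 0.
  have [r fdE] : exists r, f d = r%:E.
    by have := fNy d; have := f_fin Sd; case: (f d) => [r| |] // _ _; exists r.
  have dd : nrm (d - d) <= eps by rewrite subrr (nrm0 nrm_norm) ltW.
  have fdr : (f d <= r%:E)%E by rewrite fdE.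
  have := var _ _ _ _ fdr Sd dd; rewrite !subrr !dotr0 !add0r.
  have := c_lt Sd dd; rewrite fdE lte_fin; nra.
(* Dividing by k normalizes the coefficient of r; q = d - eps h. *)
pose k := - b; have k_gt0 : 0 < k by rewrite oppr_gt0.
exists (- (k^-1 *: a2)), (k^-1 *: a1) => u r v h fu Sv h1.
have qd : nrm (d - eps *: h - d) <= eps.
  rewrite addrAC subrr add0r (nrmN nrm_norm) (norm_scale nrm_norm) gtr0_norm //.
  by rewrite ler_piMr // ltW.
have := le_trans (ltW alpha_gt0) (var _ _ _ _ fu Sv qd).
rewrite -(pmulr_rge0 _ (_ : 0 < k^-1)) ?invr_gt0 // => var_ge0.
rewrite -subr_ge0; apply: le_trans var_ge0 _; rewrite !dot_lin.
have bk : k^-1 * b = -1 by rewrite -[b]opprK mulrN mulVf // gt_eqF.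
rewrite mulrDr mulrA bk; lra.
Qed.

End StrongDuality.

(** * Duality for one cluster *)

Lemma between_real (R : realType) (t : \bar R) (a b : R) :
  (a%:E <= t)%E -> (t <= b%:E)%E -> exists r, t = r%:E.
Proof. by case: t => [r| |] //; exists r. Qed.

Section Duality.
Context {R : realType} {m n : nat}.
Variables (g : 'rV[R]_m -> 'rV[R]_n -> \bar R) (x : 'rV[R]_n).
Variables (S : set 'rV[R]_m) (nrm : 'rV[R]_m -> R) (eps : R).
Hypotheses (nrm_norm : is_norm nrm) (eps_gt0 : 0 < eps).
Hypothesis g_proper : proper_fun (fun u => (- g u x)%E).
Hypothesis S_dom : S `<=` domu g x.
Variable d : 'rV[R]_m.
Hypothesis Sd : S d.

Definition dual_feasible (z y : 'rV[R]_m) (s : R) : Prop :=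
  (conj_neg g (z - y) x + support_fun S y - (dot z d)%:E
   + eps%:E * dual_norm nrm z <= s%:E)%E.

Lemma domu_fin u : domu g x u -> exists r, g u x = r%:E.
Proof.
rewrite /domu /=; have := g_proper.1 u.
by case: (g u x) => [r| |] // _ _; exists r.
Qed.

Lemma conj_neg_ge z u : domu g x u -> ((dot z u)%:E + g u x <= conj_neg g z x)%E.
Proof. by move=> ux; apply: ereal_sup_ubound; exists u. Qed.

Lemma support_fun_ge y v : S v -> ((dot y v)%:E <= support_fun S y)%E.
Proof. by move=> Sv; apply: ereal_sup_ubound; exists v. Qed.

(** At v in S the conjugate is at least (z - y).v + g v and the support function
    at least y.v; the y terms cancel and z.(d - v) is at most D |v - d|.  The
    bound holds outside the ball as well, with a penalty proportional to the
    excess of |v - d| over eps, which is what passing to the limit in p needs. *)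
Lemma weak_duality z y s : dual_feasible z y s ->
  exists2 D : R, 0 <= D & forall v, S v ->
    (g v x <= (s + D * (nrm (v - d) - eps))%:E)%E.
Proof.
rewrite /dual_feasible.
have D_ge0 := dual_norm_ge0 nrm_norm z.
have dA := @conj_neg_ge (z - y) _ (S_dom Sd).
have dB := support_fun_ge y Sd.
have [gd gdE] := domu_fin (S_dom Sd); rewrite gdE in dA.
have A_ge v : S v -> ((dot (z - y) v)%:E + g v x <= conj_neg g (z - y) x)%E.
  by move=> Sv; apply: conj_neg_ge; exact: S_dom.
have B_ge v := @support_fun_ge y v.
have dual_le := dot_le_dual nrm_norm (z := z).
(* None of the three suprema is -oo, so a real bound on their sum makes all of
   them real. *)
move: (conj_neg g (z - y) x) (support_fun S y) (dual_norm nrm z)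
  D_ge0 dA dB A_ge B_ge dual_le.
case=> [A| |]; case=> [B| |]; case=> [D| |] //;
  rewrite ?(gt0_muley (x := eps%:E)) ?lte_fin //=.
rewrite !lee_fin => D_ge0 _ _ A_ge B_ge dual_le sle.
exists D => // v Sv; have := A_ge _ Sv; have := B_ge _ Sv.
have [gv ->] := domu_fin (S_dom Sv); rewrite !lee_fin.
have := dual_le D (d - v) erefl.
by rewrite -(nrmN nrm_norm) opprB !dot_lin; lra.
Qed.

Hypotheses (S_convex : convex_set S) (S_closed : closed S).
Hypothesis S_bounded : bounded_set S.
Hypothesis g_convex : convex_efun (fun u => (- g u x)%E).
Hypothesis g_lsc : lower_semicontinuous (fun u => (- g u x)%E).

Lemma strong_duality (c : R) :
  (forall v, S v -> nrm (v - d) <= eps -> (g v x < c%:E)%E) ->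
  exists z y, dual_feasible z y c.
Proof.
move=> gc.
have f_fin v : S v -> (- g v x < +oo)%E.
  by move=> /S_dom/domu_fin[r ->]; rewrite ltry.
have c_lt v : S v -> nrm (v - d) <= eps -> ((- c)%:E < - g v x)%E.
  by move=> Sv vd; rewrite EFinN lteN2; exact: gc.
have [z [y zy]] := strong_duality_real S_convex S_closed S_bounded nrm_norm
  eps_gt0 g_proper.1 g_convex g_lsc f_fin Sd c_lt.
have {}zy u gu v h : g u x = gu%:E -> S v -> nrm h <= 1 ->
    dot (z - y) u + gu + dot y v - dot z d + eps * dot z h <= c.
  move=> guE Sv h1; have := zy u (- gu) v h.
  by rewrite guE !opprK => /(_ (lexx _) Sv h1); lra.
have h0 : nrm 0 <= 1 by rewrite (nrm0 nrm_norm).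
have [gd gdE] := domu_fin (S_dom Sd).
have [A AE] : exists A, conj_neg g (z - y) x = A%:E.
  apply: (@between_real _ _ (dot (z - y) d + gd) (c - dot y d + dot z d)).
    by rewrite EFinD -gdE; apply: conj_neg_ge; exact: S_dom.
  apply: ge_ereal_sup => _ [u /domu_fin[gu guE] <-]; rewrite guE lee_fin.
  by have := zy _ _ _ _ guE Sd h0; rewrite dotr0; lra.
have {}zy v h : S v -> nrm h <= 1 ->
    A + dot y v - dot z d + eps * dot z h <= c.
  move=> Sv h1; suff : (A%:E <= (c - dot y v + dot z d - eps * dot z h)%:E)%E.
    by rewrite lee_fin; lra.
  rewrite -AE; apply: ge_ereal_sup => _ [u /domu_fin[gu guE] <-].
  by rewrite guE lee_fin; have := zy _ _ _ _ guE Sv h1; lra.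
have [B BE] : exists B, support_fun S y = B%:E.
  apply: (@between_real _ _ (dot y d) (c - A + dot z d)).
    exact: support_fun_ge.
  apply: ge_ereal_sup => _ [v Sv <-]; rewrite lee_fin.
  by have := zy _ _ Sv h0; rewrite dotr0; lra.
have {}zy h : nrm h <= 1 -> A + B - dot z d + eps * dot z h <= c.
  move=> h1; suff : (B%:E <= (c - A + dot z d - eps * dot z h)%:E)%E.
    by rewrite lee_fin; lra.
  rewrite -BE; apply: ge_ereal_sup => _ [v Sv <-].
  by rewrite lee_fin; have := zy _ _ Sv h1; lra.
have dual_le : (dual_norm nrm z <= ((c - A - B + dot z d) / eps)%:E)%E.
  apply: ge_ereal_sup => _ [h h1 <-].
  by rewrite lee_fin ler_pdivlMr // mulrC; have := zy _ h1; lra.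
have [D DE] := between_real (dual_norm_ge0 nrm_norm z) dual_le.
exists z, y; move: dual_le; rewrite /dual_feasible AE BE DE !lee_fin.
by rewrite ler_pdivlMr // mulrC; lra.
Qed.

End Duality.

(** * The limit in p *)

Section PowerMean.
Context {R : realType}.

(** Lower semicontinuity suffices to close the admissible set, and it avoids
    the continuity of powR in its base, which fails at 0 from the left. *)
Lemma powR_lsc (T : topologicalType) (h : T -> R) (p : R) : 0 < p ->
  (forall t, 0 <= h t) -> continuous h ->
  lower_semicontinuous (fun t => (h t `^ p)%:E).
Proof.
move=> p0 h0 h_cont t a; rewrite lte_fin => atp.
have [a_lt0|a_ge0] := ltP a 0.
  exists setT; first exact: filterT.
  by move=> s _; rewrite lte_fin (lt_le_trans a_lt0) ?powR_ge0.
have apK : (a `^ p^-1) `^ p = a by rewrite -powRrM mulVf ?gt_eqF // powRr1.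
have /(continuous_lsc h_cont)[V tV hV] : ((a `^ p^-1)%:E < (EFin \o h) t)%E.
  rewrite /= lte_fin ltNge; apply/negP => hta.
  have : h t `^ p <= a.
    by rewrite -apK; apply: ge0_ler_powR; rewrite ?nnegrE ?powR_ge0 ?h0 // ltW.
  by rewrite leNgt atp.
exists V => // s /hV; rewrite /= !lte_fin => has.
by rewrite -apK; apply: gt0_ltr_powR; rewrite ?nnegrE ?powR_ge0 ?h0.
Qed.

(** The p-norm constraint turns into the sup-norm one: w ((eps + eta) / eps)^p
    exceeds 1 for p large. *)
Lemma powR_constraint_near (w eps eta : R) : 0 < w -> 0 < eps -> 0 < eta ->
  \forall p \near +oo, forall rho, 0 <= rho ->
    w * rho `^ p <= eps `^ p -> rho <= eps + eta.
Proof.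
move=> w0 eps0 eta0; pose q := (eps + eta) / eps.
have q1 : 1 < q by rewrite /q ltr_pdivlMr // mul1r ltrDl.
have lnq : 0 < ln q by rewrite ln_gt0.
exists (Num.max 0 (- ln w / ln q)); split; first exact: num_real.
move=> p /=; rewrite gt_max => /andP[p0 pw] rho rho0 wrho.
rewrite leNgt; apply/negP => rho_gt.
have qp : 1 < w * q `^ p.
  rewrite -ltr_pdivrMl // mulr1 -[ltLHS]lnK ?posrE ?invr_gt0 //.
  rewrite -[ltRHS]lnK ?posrE ?powR_gt0 ?(lt_trans _ q1) //.
  by rewrite ltr_expR lnV ?posrE // ln_powR -ltr_pdivrMr.
have bp : (eps + eta) `^ p = q `^ p * eps `^ p.
  by rewrite -powRM ?divfK ?gt_eqF // ltW // (lt_trans _ q1).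
have : w * (eps + eta) `^ p <= w * rho `^ p.
  rewrite ler_wpM2l ?(ltW w0) //.
  by rewrite ge0_ler_powR ?nnegrE ?(ltW p0) ?(ltW rho_gt) ?rho0 ?addr_ge0
    ?(ltW eps0) ?(ltW eta0).
move=> /le_trans /(_ wrho); apply/negP; rewrite -ltNge bp mulrA.
by rewrite ltr_pMl // powR_gt0.
Qed.

End PowerMean.

Section Limit.
Context {R : realType} {m n : nat}.
Variables (g : 'rV[R]_m -> 'rV[R]_n -> \bar R) (x : 'rV[R]_n).
Variables (S : set 'rV[R]_m) (nrm : 'rV[R]_m -> R) (eps : R).
Hypotheses (nrm_norm : is_norm nrm) (eps_gt0 : 0 < eps).
Hypothesis g_proper : proper_fun (fun u => (- g u x)%E).
Hypothesis S_dom : S `<=` domu g x.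
Hypotheses (S_convex : convex_set S) (S_closed : closed S).
Hypothesis S_bounded : bounded_set S.
Hypothesis g_convex : convex_efun (fun u => (- g u x)%E).
Hypothesis g_lsc : lower_semicontinuous (fun u => (- g u x)%E).
Context {K : nat} (w : 'I_K -> R) (d : 'I_K -> 'rV[R]_m).
Hypothesis w_gt0 : forall k, 0 < w k.
Hypothesis w_sum : \sum_k w k <= 1.
Hypothesis Sd : forall k, S (d k).

Let S_compact : compact S.
Proof. exact: bounded_closed_compact. Qed.

Let nrm_dist_continuous (c : 'rV[R]_m) :
  continuous (fun v : 'rV[R]_m => nrm (v - c)).
Proof.
move=> v; apply: (@continuous_comp _ _ _ (fun v : 'rV[R]_m => v - c) nrm).
  by apply: (@continuousB _ _ _ (@id 'rV[R]_m) (fun=> c));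
    [by []|exact: cst_continuous].
exact: nrm_continuous.
Qed.

Let obj (v : 'I_K -> 'rV[R]_m) := (\sum_(k < K) (w k)%:E * g (v k) x)%E.

Let feasible (p : R) (v : 'I_K -> 'rV[R]_m) :=
  \sum_(k < K) w k * nrm (v k - d k) `^ p <= eps `^ p /\ forall k, S (v k).

Let objE v : (forall k, S (v k)) ->
  exists2 r : 'I_K -> R, forall k, g (v k) x = (r k)%:E
                       & obj v = (\sum_k w k * r k)%:E.
Proof.
move=> Sv; have [r rE] := choice (fun k => domu_fin g_proper (S_dom (Sv k))).
by exists r => //; rewrite /obj -sumEFin; apply: eq_bigr => k _; rewrite rE EFinM.
Qed.

Let feasible_d p : 0 < p -> feasible p d.
Proof.
move=> p0; split=> //; rewrite big1 ?powR_ge0 // => k _.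
by rewrite subrr nrm0 // powR0 ?mulr0 // gt_eqF.
Qed.

(** The admissible set is closed in the product of K copies of the compact
    set S, hence compact by Tychonoff's theorem, and the objective is upper
    semicontinuous. *)
Lemma gbar_attained p : 0 < p ->
  gbar_values g S nrm eps w d x p (gbar g S nrm eps w d x p).
Proof.
move=> p0; pose T := prod_topology (fun _ : 'I_K => 'rV[R]_m).
have proj_c k : continuous (fun v : T => v k).
  exact: (@proj_continuous _ (fun _ : 'I_K => 'rV[R]_m) k).
pose A : set T := [set v | feasible p v].
have A_compact : compact A.
  have -> : A = [set v : T | forall k, S (v k)] `&`
      [set v : T | ((\sum_(k < K) (w k)%:E * (nrm (v k - d k) `^ p)%:E)%E
                     <= (eps `^ p)%:E)%E].
    apply/seteqP; split=> v /=; under eq_bigr do rewrite -EFinM;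
      by rewrite sumEFin lee_fin => -[].
  apply: compact_closedI; first exact: (tychonoff (fun=> S_compact)).
  apply: lsc_closed_sublevel; apply: lsc_sum => [k v|k].
    by rewrite -EFinM ltNyr.
  apply: lscZ => //; apply: (powR_lsc (h := fun v : T => nrm (v k - d k))) => //.
    by move=> v; exact: nrm_ge0.
  move=> v; apply: (@continuous_comp _ _ _ (fun v : T => v k)
    (fun u : 'rV[R]_m => nrm (u - d k))).
    exact: proj_c.
  exact: nrm_dist_continuous.
pose F (v : T) := (\sum_(k < K) (w k)%:E * - g (v k) x)%E.
have F_lsc : lower_semicontinuous F.
  apply: lsc_sum => [k v|k].
    have := g_proper.1 (v k); case: (- g (v k) x)%E => [r| |] // _.
      by rewrite -EFinM ltNyr.
    by rewrite gt0_muley ?lte_fin.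
  apply: lscZ => //.
  exact: (@lsc_comp R _ _ (fun v : T => v k) (fun u => (- g u x)%E)).
have FE v : A v -> F v = (- obj v)%E.
  move=> [_ Sv]; have [r rE ->] := objE Sv; rewrite /F.
  under eq_bigr do rewrite rE -EFinN -EFinM mulrN.
  by rewrite sumEFin sumrN.
have [v Av vmin] := lsc_attains_min (ex_intro A d (feasible_d p0)) A_compact F_lsc.
suff -> : gbar g S nrm eps w d x p = obj v by exists v.
apply/eqP; rewrite eq_le; apply/andP; split; last first.
  by apply: ereal_sup_ubound; exists v.
apply: ge_ereal_sup => _ [v' Av' <-].
by have := vmin _ Av'; rewrite !FE // leeN2.
Qed.

Let dual_feasibles (z y : 'I_K -> 'rV[R]_m) (s : 'I_K -> R) :=
  forall k, dual_feasible g x S nrm eps (d k) (z k) (y k) (s k).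

(** The maximizers of g over S and the balls of radius eps are admissible for
    every p, and each maximum plus e is a dual feasible level. *)
Lemma gbar_infty_le_gbar p : 0 < p ->
  (gbar_infty g S nrm eps w d x <= gbar g S nrm eps w d x p)%E.
Proof.
move=> p0.
have max_v k : exists v, [/\ S v, nrm (v - d k) <= eps &
    forall u, S u -> nrm (u - d k) <= eps -> (g u x <= g v x)%E].
  have [||v [Sv vd] vmin] := @lsc_attains_min R _ _
      (S `&` [set v : 'rV[R]_m | nrm (v - d k) <= eps]) _ _ g_lsc.
  - by exists (d k); split=> //=; rewrite subrr nrm0 // ltW.
  - apply: compact_closedI => //.
    apply: (preimage_closed (f := fun v : 'rV[R]_m => nrm (v - d k))
      (D := [set t | t <= eps])).
      by move=> v _; exact: nrm_dist_continuous.
    exact: closed_le.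
  - by exists v; split=> // u Su ud; rewrite -leeN2; exact: vmin.
have [v vP] := choice max_v.
have Sv k : S (v k) by have [] := vP k.
have [r rE obj_v] := objE Sv.
have : (obj v <= gbar g S nrm eps w d x p)%E.
  apply: ereal_sup_ubound; exists v => //; split=> //.
  apply: (@le_trans _ _ (\sum_k w k * eps `^ p)); last first.
    by rewrite -mulr_suml ler_piMl ?powR_ge0.
  apply: ler_sum => k _; rewrite ler_wpM2l ?(ltW (w_gt0 k)) //.
  have [_ vd _] := vP k.
  by apply: ge0_ler_powR; rewrite ?nnegrE ?nrm_ge0 ?(ltW eps_gt0) ?(ltW p0).
apply: le_trans; apply/lee_addgt0Pr => e e0.
have zyP k : exists zy : 'rV[R]_m * 'rV[R]_m,
    dual_feasible g x S nrm eps (d k) zy.1 zy.2 (r k + e).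
  have [|z [y zy]] := strong_duality nrm_norm eps_gt0 g_proper S_dom (Sd k)
    S_convex S_closed S_bounded g_convex g_lsc (c := r k + e).
    move=> u Su ud; have [_ _ /(_ u Su ud)] := vP k; rewrite rE => /le_lt_trans.
    by apply; rewrite lte_fin ltrDl.
  by exists (z, y).
have [zy zyE] := choice zyP.
apply: (@le_trans _ _ (\sum_(k < K) w k * (r k + e))%:E).
  apply: ereal_inf_lbound.
  by exists (fun k => (zy k).1), (fun k => (zy k).2), (fun k => r k + e).
rewrite obj_v -EFinD lee_fin; under eq_bigr do rewrite mulrDr.
by rewrite big_split /= -mulr_suml lerD2l ler_piMl // ltW.
Qed.

(** With every point of an admissible family at distance at most eps + eta from
    its centroid, weak duality loses at most eta times the weighted sum of the
    dual norms. *)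
Lemma gbar_le_near z y s e : dual_feasibles z y s -> 0 < e ->
  \forall p \near +oo,
    (gbar g S nrm eps w d x p <= (\sum_(k < K) w k * s k + e)%:E)%E.
Proof.
move=> zys e0.
have DP k : exists D : R, 0 <= D /\ forall v, S v ->
    (g v x <= (s k + D * (nrm (v - d k) - eps))%:E)%E.
  have [D D0 Dle] :=
    weak_duality nrm_norm eps_gt0 g_proper S_dom (Sd k) (zys k).
  by exists D.
have [D DE] := choice DP.
have D_ge0 k : 0 <= D k by have [] := DE k.
have wD_ge0 k : 0 <= w k * D k by rewrite mulr_ge0 // ltW.
(* The summand 1 keeps eta = e / M defined when all dual norms vanish. *)
pose M := 1 + \sum_k w k * D k.
have M0 : 0 < M by rewrite ltr_pwDl // sumr_ge0.
have : \forall p \near +oo, forall k rho, 0 <= rho ->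
    w k * rho `^ p <= eps `^ p -> rho <= eps + e / M.
  by apply: filter_forall => k; apply: powR_constraint_near => //; exact: divr_gt0.
apply: filterS => p rho_le; apply: ge_ereal_sup => _ [v [vp Sv] <-].
have [r rE] := objE Sv; rewrite /obj => ->; rewrite lee_fin.
have v_le k : nrm (v k - d k) <= eps + e / M.
  apply: (rho_le k); first exact: nrm_ge0.
  apply: le_trans vp; rewrite (bigD1 k) //= lerDl sumr_ge0 // => j _.
  by rewrite mulr_ge0 ?powR_ge0 // ltW.
apply: (@le_trans _ _ (\sum_k (w k * s k + (w k * D k) * (e / M)))).
  apply: ler_sum => k _; rewrite -mulrA -mulrDr ler_wpM2l ?(ltW (w_gt0 k)) //.
  have [_ /(_ _ (Sv k))] := DE k; rewrite rE lee_fin => /le_trans; apply.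
  by rewrite lerD2l ler_wpM2l // lerBlDl.
rewrite big_split /= lerD2l -mulr_suml mulrCA ler_piMr ?(ltW e0) //.
by rewrite ler_pdivrMr // mul1r /M lerDr.
Qed.

Lemma gbar_cvg :
  gbar g S nrm eps w d x p @[p --> +oo] --> gbar_infty g S nrm eps w d x.
Proof.
pose G := gbar_infty g S nrm eps w d x.
have [gd gdE _] := objE Sd.
(* The centroids themselves are admissible, so g at the centroids bounds every
   dual feasible value from below. *)
have G_ge : ((\sum_k w k * gd k)%:E <= G)%E.
  apply: le_ereal_inf_tmp => _ [z [y [s [zys ->]]]]; rewrite lee_fin.
  apply: ler_sum => k _; rewrite ler_wpM2l ?(ltW (w_gt0 k)) //.
  have [D D0 /(_ _ (Sd k))] :=
    weak_duality nrm_norm eps_gt0 g_proper S_dom (Sd k) (zys k).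
  rewrite gdE subrr nrm0 // lee_fin => /le_trans; apply.
  by rewrite sub0r mulrN gerBl mulr_ge0 // ltW.
have [M G_le] : exists M : R, (G <= M%:E)%E.
  have [v [_ Sv] vE] := gbar_attained ltr01; have [r _ obj_v] := objE Sv.
  exists (\sum_k w k * r k); rewrite -obj_v /obj vE.
  exact: gbar_infty_le_gbar.
have [l lE] := between_real G_ge G_le.
have near_le e : 0 < e ->
    \forall p \near +oo, (l%:E <= gbar g S nrm eps w d x p <= (l + e)%:E)%E.
  move=> e0.
  have [t [z [y [s [zys ->]]]] tl] : exists2 t : \bar R,
      [set t | exists (z y : 'I_K -> 'rV[R]_m) (s : 'I_K -> R),
        dual_feasibles z y s /\ t = (\sum_(k < K) w k * s k)%:E] t &
      (t < (l + e / 2)%:E)%E.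
    by apply: ereal_inf_lt; rewrite -/G -[ereal_inf _]/G lE lte_fin ltrDl divr_gt0.
  have e20 : 0 < e / 2 by rewrite divr_gt0.
  near=> p; apply/andP; split.
    by rewrite -lE; apply: gbar_infty_le_gbar; near: p; exact: nbhs_pinfty_gt.
  apply: (@le_trans _ _ (\sum_(k < K) w k * s k + e / 2)%:E).
    by near: p; exact: gbar_le_near.
  by move: tl; rewrite lte_fin lee_fin; lra.
rewrite -/G lE; apply/fine_cvgP; split.
  by apply: filterS (near_le 1 ltr01) => p /andP[lp pl];
    have [r ->] := between_real lp pl.
apply/cvgrPdist_le => e /near_le; apply: filterS => p /andP[lp pl] /=.
have [r rE] := between_real lp pl; move: lp pl; rewrite rE !lee_fin /= => lr rl.
by rewrite ler_distl; apply/andP; split; lra.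
Unshelve. all: by end_near.
Qed.

End Limit.

(** * Clusters and the theorem *)

Section Clustering.
Context {R : realType} {m N K : nat} (C : 'I_K -> {set 'I_N}).
Hypothesis C_clust : is_clustering C.

Lemma cluster_card_gt0 k : (0 < #|C k|)%N.
Proof.
have [_ /and3P[_ _ C0]] := C_clust.
rewrite card_gt0; apply: contraNneq C0 => <-.
exact: imset_f.
Qed.

Lemma weight_gt0 k : 0 < weight C k :> R.
Proof.
have Ck := cluster_card_gt0 k.
have N0 : (0 < N)%N by rewrite -(card_ord N) (leq_trans Ck) // max_card.
by rewrite divr_gt0 ?ltr0n.
Qed.

Lemma weight_sum : \sum_(k < K) weight C k <= 1 :> R.
Proof.
have [C_inj C_part] := C_clust; rewrite /weight -mulr_suml -natr_sum.
have := card_partition C_part; rewrite cardsT card_ord.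
rewrite big_imset /=; last by move=> i j _ _; exact: C_inj.
under eq_bigl do rewrite inE.
move=> <-.
have [->|N0] := eqVneq N 0; first by rewrite mul0r.
by rewrite divff // pnatr_eq0.
Qed.

Lemma centroid_mem (S : set 'rV[R]_m) (data : 'I_N -> 'rV[R]_m) k :
  convex_set S -> (forall i, S (data i)) -> S (centroid data C k).
Proof.
move=> S_convex data_S; rewrite /centroid.
have := cluster_card_gt0 k; rewrite cardE -big_enum.
case: (enum (C k)) => [//|i r] _.
exact: convex_set_mean.
Qed.

End Clustering.

Theorem theoremA2 (R : realType) (m n N K : nat)
    (S : set 'rV[R]_m) (X : set 'rV[R]_n)
    (g : 'rV[R]_m -> 'rV[R]_n -> \bar R)
    (nrm : 'rV[R]_m -> R) (eps : R)
    (data : 'I_N -> 'rV[R]_m) (C : 'I_K -> {set 'I_N})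
    (S_convex : convex_set S) (S_closed : closed S) (S_bounded : bounded_set S)
    (X_compact : compact X)
    (g_proper : forall x, X x -> proper_fun (fun u => (- g u x)%E))
    (g_convex : forall x, X x -> convex_efun (fun u => (- g u x)%E))
    (g_lsc : forall x, X x -> lower_semicontinuous (fun u => (- g u x)%E))
    (dom_indep : forall x x', X x -> X x' -> domu g x = domu g x')
    (S_dom : forall x, X x -> S `<=` domu g x)
    (g_dom : domain_alternative g X)
    (nrm_norm : is_norm nrm) (eps_gt0 : 0 < eps)
    (data_S : forall i, S (data i)) (C_clust : is_clustering C) :
  let w : 'I_K -> R := weight C in
  let d : 'I_K -> 'rV[R]_m := centroid data C in
  forall x, X x ->
    (forall p : R, 1 <= p ->
       gbar_values g S nrm eps w d x p (gbar g S nrm eps w d x p)) /\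
    gbar g S nrm eps w d x p @[p --> +oo] --> gbar_infty g S nrm eps w d x.
Proof.
move=> w d x Xx.
have w_gt0 k : 0 < w k by exact: (weight_gt0 C_clust).
have w_sum : \sum_(k < K) w k <= 1 by exact: (weight_sum C_clust).
have d_S k : S (d k) by exact: (centroid_mem C_clust).
have x_proper := g_proper _ Xx; have x_lsc := g_lsc _ Xx.
have x_dom := S_dom _ Xx.
split=> [p p1|]; last by apply: gbar_cvg => //; exact: g_convex.
by apply: gbar_attained => //; exact: lt_le_trans p1.
Qed.
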